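(* Fix a cooperative Markov game, target and avoid sets, and a stationary joint policy $\pi$ with $v^{full}>0$, as described in the context. Let $p\in[0,1]$. Suppose the loss time in imaginary play (Algorithm 1) is random, independent of the game's randomness, with $\Pr(t_{loss}=t)=(1-p)^tp$ for $t=0,1,2,\dots$. Let $v^{img}$ be the resulting reach-avoid probability. Then $$v^{img}\ge\max\Big(v^{full}-\sqrt{1-\exp(-C_\pi)},\;v^{full}(1-p)^{\,l^{full}/v^{full}}\Big).$$
   Context: Multiagent model: there are $N$ agents. Agent $i$ is modeled by a finite MDP $\mathcal{M}^i=(\mathcal{S}^i,s_I^i,\mathcal{A}^i,\mathcal{T}^i)$. Here $\mathcal{S}^i$ is a finite state set, $s_I^i\in\mathcal{S}^i$ is the initial state, $\mathcal{A}^i$ is a finite action set, and $\mathcal{T}^i:\mathcal{S}^i\times\mathcal{A}^i\to\Delta(\mathcal{S}^i)$ is the transition kernel. The cooperative Markov game has joint state set $\mathbf{S}=\prod_i\mathcal{S}^i$, joint initial state $\mathbf{s}_I=(s_I^1,\dots,s_I^N)$, and joint action set $\mathbf{A}=\prod_i\mathcal{A}^i$. Its transition kernel is $\mathbf{T}(\mathbf{s},\mathbf{a},\mathbf{y})=\prod_{i}\mathcal{T}^i(s^i,a^i,y^i)$. A stationary joint policy is a map $\pi:\mathbf{S}\to\Delta(\mathbf{A})$. A joint path is an infinite sequence $\mathbf{s}_0\mathbf{a}_0\mathbf{s}_1\mathbf{a}_1\cdots\in(\mathbf{S}\times\mathbf{A})^\omega$ with $\mathbf{s}_0=\mathbf{s}_I$.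 All random sampling below is mutually independent given the stated conditioning. Full-communication execution: at each time $t$, $\mathbf{a}_t\sim\pi(\mathbf{s}_t)$ is drawn once for the whole team. Each agent $i$ then moves to $s^i_{t+1}\sim\mathcal{T}^i(s^i_t,a^i_t)$. $\Gamma^{full}$ denotes the resulting distribution over joint paths. Imaginary play with loss time $t_{loss}\in\{0,1,\dots\}\cup\{\infty\}$ (Algorithm 1): - For $t<t_{loss}$, the team acts exactly as under full communication. Each agent $i$ records $\hat s^j_{t,i}=s^j_t$ for all $j\ne i$, and records $\hat{\mathbf a}_{t,i}=\mathbf a_t$. - For $t\ge t_{loss}$, each agent $i$ acts separately and does not observe the others. First it sets its imaginary teammate states. If $t=0$, it sets $\hat s^j_{0,i}=s_I^j$ for $j\neq i$. Otherwise it samples $\hat s^j_{t,i}\sim\mathcal{T}^j(\hat s^j_{t-1,i},\hat a^j_{t-1,i})$ for $j\ne i$, where $\hat a^j_{t-1,i}$ is the $j$-th component of $\hat{\mathbf a}_{t-1,i}$. - Agent $i$ then samples its own joint action $\hat{\mathbf a}_{t,i}\sim\pi(\hat s^1_{t,i},\dots,\hat s^{i-1}_{t,i},s^i_t,\hat s^{i+1}_{t,i},\dots,\hat s^N_{t,i})$. - Agent $i$ executes only its own component $\hat a^i_{t,i}$, and moves to $s^i_{t+1}\sim\mathcal{T}^i(s^i_t,\hat a^i_{t,i})$. - The realized joint action at time $t$ is $\mathbf a_t=(\hat a^1_{t,1},\dots,\hat a^N_{t,N})$. $\Gamma^{img}_{t_{loss}}$ denotes the induced distribution over realized joint paths. Total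 correlation: let $\mathbf X$ be the random joint path under $\Gamma^{full}$, and $X^i$ its projection $s^i_0a^i_0s^i_1a^i_1\cdots$ onto agent $i$. The total correlation of $\pi$ is $$C_\pi=\Big[\sum_{i=1}^N H(X^i)\Big]-H(\mathbf X)=KL(\Gamma^{full}\|\Gamma^{img}_0).$$ The equality holds because $\Gamma^{img}_0$ is the product of the agents' marginal path distributions under $\Gamma^{full}$. Reach-avoid objective: a target set $\mathbf S_{\mathcal T}\subseteq\mathbf S$ and an avoid set $\mathbf S_{\mathcal A}\subseteq\mathbf S$ are given. A joint path succeeds if there is $M$ with $\mathbf s_M\in\mathbf S_{\mathcal T}$ and $\mathbf s_t\notin\mathbf S_{\mathcal A}$ for all $t<M$. $v^{full}$ is the success probability under $\Gamma^{full}$. Path length: $\mathbf S_{\mathcal D}$ is the set of joint states from which, under $\pi$ with full communication, the probability of success is $0$. For a path $\xi$, $len(\xi)=\min\{t+1:\mathbf s_t\in\mathbf S_{\mathcal T}\cup\mathbf S_{\mathcal D}\}$. Finally, $l^{full}=\mathbb E_{\xi\sim\Gamma^{full}}[len(\xi)]$. *)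

(* Defs.v *)
From HB Require Import structures.
From mathcomp Require Import all_boot all_order all_algebra.
From mathcomp Require Import all_classical all_reals.
From mathcomp Require Import ereal exp sequences.
Set Implicit Arguments.
Unset Strict Implicit.
Unset Printing Implicit Defensive.
Import Order.TTheory GRing.Theory Num.Theory.
Local Open Scope ring_scope.

(* Being a probability kernel is a hypothesis of the main theorem.          *)
Record game (N : nat) (R : realType) := Game {
  st : 'I_N -> finType;
  ac : 'I_N -> finType;
  init : forall i, st i;
  trans : forall i, st i -> ac i -> st i -> R }.

Arguments st {N R} g i.
Arguments ac {N R} g i.
Arguments init {N R} g i.
Arguments trans {N R} g i _ _ _.

Section MultiAgent.
Variables (N : nat) (R : realType) (G : game N R).

Definition JS : finType := {dffun forall i : 'I_N, st G i}.
Definition JA : finType := {dffun forall i : 'I_N, ac G i}.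

Definition sI : JS := [ffun i => init G i].

Definition jtrans (s : JS) (a : JA) (y : JS) : R :=
  \prod_(i < N) trans G i (s i) (a i) (y i).

Definition is_kernel : Prop :=
  (forall i s a s', 0 <= trans G i s a s') /\
  (forall i s a, \sum_(s' : st G i) trans G i s a s' = 1).

Variable pi : JS -> JA -> R.
Variables ST SA : {set JS}.

Definition is_policy : Prop :=
  (forall s a, 0 <= pi s a) /\ (forall s, \sum_(a : JA) pi s a = 1).

Fixpoint pfull_from (prev : JS * JA) (w : seq (JS * JA)) : R :=
  match w with
  | [::] => 1
  | (s, a) :: w' => jtrans prev.1 prev.2 s * pi s a * pfull_from (s, a) w'
  end.

Definition pfull (x : JS) (w : seq (JS * JA)) : R :=
  match w with
  | [::] => 1
  | (s, a) :: w' => (s == x)%:R * pi s a * pfull_from (s, a) w'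
  end.

Definition succ (w : seq (JS * JA)) : bool :=
  let ss := map fst w in
  has (fun M => (nth sI ss M \in ST) &&
                all (fun t => nth sI ss t \notin SA) (iota 0 M))
      (iota 0 (size w)).

Definition succ_full_T (x : JS) (T : nat) : R :=
  \sum_(w : T.-tuple (JS * JA)) pfull x w * (succ w)%:R.

(* success probability of the infinite path = sup over horizons
   (the success event is the increasing union of the horizon-T events) *)
Definition vfull_from (x : JS) : R :=
  sup [set r | exists T, r = succ_full_T x T].

Definition v_full : R := vfull_from sI.

Definition SD : {set JS} := [set x | vfull_from x == 0].

(* min(len(xi), T), which only depends on the length-T prefix;
   len(xi) = min{t+1 : s_t \in S_T \cup S_D} *)
Definition len_trunc (w : seq (JS * JA)) : nat :=
  minn (find (fun s => (s \in ST) || (s \in SD)) (map fst w)).+1 (size w).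

(* l^full = E[len] = sup_T E[min(len,T)]  (monotone convergence) *)
Definition l_full : \bar R :=
  ereal_sup [set ((\sum_(w : T.-tuple (JS * JA))
                    pfull sI w * (len_trunc w)%:R)%:E) | T in [set: nat]].

(* Internal record at time t: for each agent i, the pair
   (v_{t,i}, \hat a_{t,i}) where v_{t,i} is agent i's view of the joint
   state (own component = its real state s^i_t, component j <> i =
   \hat s^j_{t,i}) and \hat a_{t,i} is the joint action it sampled.       *)
Definition Rec : finType := {ffun 'I_N -> (JS * JA)%type}.

Definition rstate (r : Rec) : JS := [ffun k => (r k).1 k].
Definition ract (r : Rec) : JA := [ffun k => (r k).2 k].

Definition act_fac (tl t : nat) (r : Rec) : R :=
  if (t < tl)%N then
    (* common draw a_t ~ pi(s_t); all agents record the true state/action *)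
    ([forall i, ((r i).1 == rstate r) && ((r i).2 == ract r)])%:R
      * pi (rstate r) (ract r)
  else \prod_(i < N) pi (r i).1 (r i).2.

(* probability factor of the state draws leading from record [prev]
   (time t-1) to record [r] (time t), t >= 1 *)
Definition state_fac (tl t : nat) (prev r : Rec) : R :=
  (* real moves s^i_t ~ T^i(s^i_{t-1}, a^i_{t-1}) *)
  (\prod_(i < N) trans G i ((prev i).1 i) ((prev i).2 i) ((r i).1 i)) *
  (if (t < tl)%N then 1
   else (* imagined teammates \hat s^j_{t,i} ~ T^j(\hat s^j_{t-1,i}, \hat a^j_{t-1,i}) *)
     \prod_(i < N) \prod_(j < N | j != i)
        trans G j ((prev i).1 j) ((prev i).2 j) ((r i).1 j)).

Fixpoint pimg_from (tl t : nat) (prev : Rec) (w : seq Rec) : R :=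
  match w with
  | [::] => 1
  | r :: w' => state_fac tl t prev r * act_fac tl t r * pimg_from tl t.+1 r w'
  end.

(* probability of the internal record over times 0..size w - 1, for the
   (deterministic) loss time tl; at t = 0 every view is s_I
   (real initial state, resp. \hat s^j_{0,i} = s_I^j) *)
Definition pimg (tl : nat) (w : seq Rec) : R :=
  match w with
  | [::] => 1
  | r :: w' => ([forall i, (r i).1 == sI])%:R * act_fac tl 0 r
                 * pimg_from tl 1 r w'
  end.

Definition realize (w : seq Rec) : seq (JS * JA) :=
  map (fun r => (rstate r, ract r)) w.

Definition pimg_prefix (tl : nat) (T : nat) (u : T.-tuple (JS * JA)) : R :=
  \sum_(w : T.-tuple Rec | realize w == u) pimg tl w.

Definition v_img_at (tl : nat) : R :=
  sup [set r | exists T,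
         r = \sum_(w : T.-tuple Rec) pimg tl w * (succ (realize w))%:R].

(* random loss time: Pr(t_loss = t) = (1-p)^t p, remaining mass
   (1 if p = 0, else 0) on t_loss = oo, where play = full communication *)
Definition v_img (p : R) : \bar R :=
  (\sum_(0 <= t <oo) (((1 - p) ^+ t * p * v_img_at t)%:E) +
   ((p == 0)%:R * v_full)%:E)%E.

Definition KL (T : finType) (P Q : T -> R) : \bar R :=
  (\sum_(x : T) (if P x == 0%R then 0%E
                 else if Q x == 0%R then +oo%E
                 else (P x * ln (P x / Q x))%:E))%E.

(* C_pi = KL(Gamma^full || Gamma^img_0), the KL divergence of the path
   measures = sup of KL divergences of their length-T prefix marginals *)
Definition C_pi : \bar R :=
  ereal_sup [set KL (fun u : T.-tuple (JS * JA) => pfull sI u)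
                    (pimg_prefix 0 (T:=T)) | T in [set: nat]].

(* the two terms of the bound; exp(-oo) = 0 and x^(+oo) = 0 for
   0 <= x < 1, 1^(+oo) = 1 (these infinite cases are conventions) *)
Definition bound_corr : R :=
  match C_pi with
  | r%:E => v_full - Num.sqrt (1 - expR (- r))
  | _ => v_full - 1
  end.

Definition bound_len (p : R) : R :=
  match l_full with
  | r%:E => v_full * powR (1 - p) (r / v_full)
  | _ => v_full * (p == 0)%:R
  end.

End MultiAgent.

(* Main.v *)
Require Import Defs.
From HB Require Import structures.
From mathcomp Require Import all_boot all_order all_algebra.
From mathcomp Require Import all_classical all_reals.
From mathcomp Require Import ereal exp sequences.
From mathcomp Require Import ring lra.
Import Order.TTheory GRing.Theory Num.Theory.
Local Open Scope ring_scope.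
Set Implicit Arguments.
Unset Strict Implicit.

(* Correlation bound. A horizon-n prefix law of imaginary play with loss time t
   factors as P(h) * prod_i P(s_i | h), where h is the first t steps and s_i the
   continuation of agent i. Dividing the law for loss time 0 by it gives
     [prod_i P(h_i) / P(h)] * prod_i [P(h_i, s_i) / (P(h_i) * P(s_i | h))],
   and every bracket has mean at most 1 under full communication, so
   E ln(bracket) <= 0 and KL(full || img_t) <= KL(full || img_0) <= C_pi.
   Bretagnolle-Huber turns this into a bound on the success probabilities.

   Length bound. With F n the probability of success within n steps,
   imaginary play with loss time t succeeds with probability at least F t, and
   sum_t q^t (1-q) F t = sum_k q^k (F k - F (k-1)), with q = 1-p. Since
   sum_k k (F k - F (k-1)) <= l_full and F tends to v_full, the tangent line of
   the exponential at (l_full / v_full) ln q gives Jensen's bound. *)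

(** * Splitting sums over tuples *)

Section TupleSums.
Variables (R : realType) (T : finType).
Implicit Types F : seq T -> R.

Lemma sum_tuple0 F : \sum_(w : 0.-tuple T) F w = F [::].
Proof.
rewrite (bigD1 [tuple]) //= big1 ?addr0 // => w /eqP[].
exact/val_inj/size0nil/size_tuple.
Qed.

Lemma sum_tuple_cons n F :
  \sum_(w : n.+1.-tuple T) F w = \sum_z \sum_(w : n.-tuple T) F (z :: w).
Proof.
rewrite pair_big /= (reindex (fun x : T * n.-tuple T => cons_tuple x.1 x.2)) //=.
exists (fun w => (thead w, behead_tuple w)) => [[z w] _|w _] /=.
  by congr pair; apply: val_inj.
by apply: val_inj; case/tupleP: w.
Qed.

Lemma sum_tuple_cat m n F :
  \sum_(w : (m + n).-tuple T) F w =
  \sum_(u : m.-tuple T) \sum_(v : n.-tuple T) F (u ++ v).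
Proof.
elim: m F => [|m IHm] F.
  by rewrite (sum_tuple0 (fun u => \sum_(v : n.-tuple T) F (u ++ v))).
rewrite sum_tuple_cons.
rewrite (sum_tuple_cons m (fun u => \sum_(v : n.-tuple T) F (u ++ v))).
by apply: eq_bigr => z _; rewrite (IHm (fun w => F (z :: w))).
Qed.

End TupleSums.

(** * Products of sums over finite functions *)

Section ProductSums.
Variable R : realType.

Lemma sum_dffun_prod (I : finType) (T : I -> finType) (f : forall i, T i -> R) :
  \sum_(y : {dffun forall i, T i}) \prod_i f i (y i) = \prod_i \sum_x f i x.
Proof.
pose P_ i := [ffun x => f i x].
under [RHS]eq_bigr => i _ do
  (under eq_bigr => x _ do rewrite -[f i x](ffunE (f i)); rewrite (big_tag P_)).
rewrite bigA_distr_big_dep -(big_fprod _ _ P_).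
rewrite (reindex (@dffun_of_fprod I T)); last exact/onW_bij/dffun_of_fprod_bij.
by apply: eq_bigr => y _; apply: eq_bigr => i _; rewrite !ffunE.
Qed.

(* Tuples of finite functions are transposed into finite functions of tuples. *)
Lemma sum_tuple_ffun_prod (I Z : finType) n (Q : I -> pred (seq Z))
    (f : I -> seq Z -> R) :
  \sum_(w : n.-tuple {ffun I -> Z} |
        [forall i, Q i [seq (r : {ffun I -> Z}) i | r <- w]])
     \prod_i f i [seq (r : {ffun I -> Z}) i | r <- w] =
  \prod_i \sum_(s : n.-tuple Z | Q i s) f i s.
Proof.
rewrite bigA_distr_big_dep.
pose h (g : {ffun I -> n.-tuple Z}) : n.-tuple {ffun I -> Z} :=
  [tuple [ffun i => tnth (g i) k] | k < n].
have hE g i : [seq (r : {ffun I -> Z}) i | r <- h g] = g i.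
  rewrite /= -map_comp -[RHS]map_tnth_enum; apply: eq_map => k /=.
  by rewrite ffunE.
rewrite (reindex h) /=.
  apply: eq_big => [g|g _]; last by apply: eq_bigr => i _; rewrite hE.
  apply/forallP/familyP => H i; move: (H i); rewrite ?hE //.
exists (fun w => [ffun i => map_tuple (fun r : {ffun I -> Z} => r i) w]) => [g|w] _.
  by apply/ffunP => i; apply: val_inj; rewrite ffunE /= hE.
apply: eq_from_tnth => k; apply/ffunP => i.
by rewrite tnth_mktuple !ffunE tnth_map.
Qed.

End ProductSums.

(* Keeps [/=] from unfolding the carriers of [JS], [JA], [Rec] into finite
   functions, which would hide their finType structures. *)
Local Arguments JS : simpl never.
Local Arguments JA : simpl never.
Local Arguments Rec : simpl never.

(** * Path laws before and after the loss *)

Section Play.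
Variables (N : nat) (R : realType) (G : game N R) (pi : JS G -> JA G -> R).
Hypotheses (hK : is_kernel G) (hpi : is_policy pi).
Local Notation Z := (JS G * JA G)%type.
Implicit Types (h s u : seq Z) (w : seq (Rec G)).

Lemma jtrans_ge0 x a y : 0 <= jtrans (G := G) x a y.
Proof. by apply: prodr_ge0 => i _; apply: (proj1 hK). Qed.

Lemma sum_jtrans x a : \sum_y jtrans (G := G) x a y = 1.
Proof.
rewrite /jtrans (sum_dffun_prod (fun i y => trans G i (x i) (a i) y)).
by rewrite big1 // => i _; apply: (proj2 hK).
Qed.

Lemma pfull_from_ge0 z s : 0 <= pfull_from pi z s.
Proof.
elim: s z => [|[x a] s IHs] z //=.
by rewrite mulr_ge0 // mulr_ge0 ?jtrans_ge0 //; apply: (proj1 hpi).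
Qed.

Lemma sum_pfull_from n z : \sum_(s : n.-tuple Z) pfull_from pi z s = 1.
Proof.
elim: n z => [|n IHn] z; first by rewrite (sum_tuple0 (pfull_from pi z)).
rewrite (sum_tuple_cons n (pfull_from pi z)) /=.
transitivity (\sum_(x : JS G) \sum_(a : JA G) jtrans z.1 z.2 x * pi x a).
  rewrite [RHS]pair_big /=; apply: eq_bigr => -[x a] _ /=.
  by rewrite -mulr_sumr IHn mulr1.
rewrite -[RHS](sum_jtrans z.1 z.2); apply: eq_bigr => x _.
by rewrite -mulr_sumr (proj2 hpi) mulr1.
Qed.

Lemma pfull_ge0 x s : 0 <= pfull pi x s.
Proof.
case: s => [|[y a] s] //=.
by rewrite mulr_ge0 ?pfull_from_ge0 // mulr_ge0 //; apply: (proj1 hpi).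
Qed.

Lemma sum_pfull n x : \sum_(s : n.-tuple Z) pfull pi x s = 1.
Proof.
case: n => [|n]; first by rewrite (sum_tuple0 (pfull pi x)).
rewrite (sum_tuple_cons n (pfull pi x)) /=.
transitivity (\sum_(y : JS G) \sum_(a : JA G) (y == x)%:R * pi y a).
  rewrite [RHS]pair_big /=; apply: eq_bigr => -[y a] _ /=.
  by rewrite -mulr_sumr sum_pfull_from mulr1.
rewrite (bigD1 x) //= [X in _ + X]big1 => [|y /negPf->].
  by rewrite addr0 -mulr_sumr (proj2 hpi) eqxx mulr1.
by rewrite big1 // => a _; rewrite mul0r.
Qed.

(* Law of the continuation [s] of the history [h] under full communication. *)
Definition pcont h s : R :=
  if h is z :: h' then pfull_from pi (last z h') s else pfull pi (sI G) s.

Lemma pcont_ge0 h s : 0 <= pcont h s.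
Proof. by case: h => [|z h]; [apply: pfull_ge0 | apply: pfull_from_ge0]. Qed.

Lemma sum_pcont n h : \sum_(s : n.-tuple Z) pcont h s = 1.
Proof. by case: h => [|z h]; [apply: sum_pfull | apply: sum_pfull_from]. Qed.

Lemma pfull_from_cat z h s :
  pfull_from pi z (h ++ s) = pfull_from pi z h * pfull_from pi (last z h) s.
Proof.
by elim: h z => [|[x a] h IHh] z /=; rewrite ?mul1r // IHh !mulrA.
Qed.

Lemma pfull_cat h s :
  pfull pi (sI G) (h ++ s) = pfull pi (sI G) h * pcont h s.
Proof.
by case: h => [|[x a] h] /=; rewrite ?mul1r // pfull_from_cat !mulrA.
Qed.

(** A step before the loss: all agents hold the same joint state and action, so the record carries a
    single pair. *)
Definition diag (z : Z) : Rec G := [ffun _ => z].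

Definition view (i : 'I_N) w : seq Z := [seq (r : Rec G) i | r <- w].

Definition synced w : bool := w == map diag (realize w).

Lemma rstate_diag z : rstate (diag z) = z.1.
Proof. by apply/ffunP => i; rewrite !ffunE. Qed.

Lemma ract_diag z : ract (diag z) = z.2.
Proof. by apply/ffunP => i; rewrite !ffunE. Qed.

Lemma realize_diag h : realize (map diag h) = h.
Proof.
rewrite /realize -map_comp -[RHS]map_id; apply: eq_map => -[x a] /=.
by rewrite rstate_diag ract_diag.
Qed.

Lemma act_fac_full tl t (r : Rec G) : (t < tl)%N ->
  act_fac pi tl t r =
  (r == diag (rstate r, ract r))%:R * pi (rstate r) (ract r).
Proof.
rewrite /act_fac => ->; congr ((nat_of_bool _)%:R * _).
apply/forallP/eqP => [H|rE i]; last first.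
  have -> : r i = (rstate r, ract r) by rewrite {1}rE ffunE.
  by rewrite !eqxx.
apply/ffunP => i; rewrite ffunE; have /andP[/eqP <- /eqP <-] := H i.
by case: (r i).
Qed.

Lemma state_fac_full tl t z (r : Rec G) : (t < tl)%N ->
  state_fac tl t (diag z) r = jtrans z.1 z.2 (rstate r).
Proof.
by rewrite /state_fac => ->; rewrite mulr1; apply: eq_bigr => i _; rewrite !ffunE.
Qed.

(** An agent's real move and its imagined teammates' moves combine into one joint transition of its
    view, so after the loss each agent runs a private copy of the full-communication chain. *)
Lemma state_fac_img tl t (z r : Rec G) : (tl <= t)%N ->
  state_fac tl t z r = \prod_i jtrans (z i).1 (z i).2 (r i).1.
Proof.
rewrite /state_fac ltnNge => -> /=; rewrite -big_split /=.
by apply: eq_bigr => i _; rewrite /jtrans [in RHS](bigD1 i).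
Qed.

Lemma act_fac_img tl t (r : Rec G) : (tl <= t)%N ->
  act_fac pi tl t r = \prod_i pi (r i).1 (r i).2.
Proof. by rewrite /act_fac ltnNge => ->. Qed.

Lemma pimg_from_img tl t (z : Rec G) w : (tl <= t)%N ->
  pimg_from pi tl t z w = \prod_i pfull_from pi (z i) (view i w).
Proof.
elim: w t z => [|r w IHw] t z le_tl /=; first by rewrite big1.
rewrite IHw ?leqW // state_fac_img // act_fac_img // -!big_split /=.
by apply: eq_bigr => i _; case: (r i).
Qed.

Lemma synced_cons r w :
  synced (r :: w) = (r == diag (rstate r, ract r)) && synced w.
Proof. by rewrite /synced /= eqseq_cons. Qed.

(** [wh] fills exactly the steps from [t] up to the loss; its last pair is the common starting point
    of all private copies. *)
Lemma pimg_from_cat tl t z wh ws : (t + size wh = tl)%N ->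
  pimg_from pi tl t (diag z) (wh ++ ws) =
  (synced wh)%:R * pfull_from pi z (realize wh) *
    \prod_i pfull_from pi (last z (realize wh)) (view i ws).
Proof.
elim: wh t z => [|r wh IHw] t z /= def_tl.
  rewrite !mul1r pimg_from_img; last by rewrite -def_tl addn0.
  by apply: eq_bigr => i _; rewrite ffunE.
have lt_t : (t < tl)%N by rewrite -def_tl -addSnnS leq_addr.
rewrite state_fac_full // act_fac_full // synced_cons.
case: eqP => [rE|_]; last by rewrite /= !(mul0r, mulr0).
rewrite [X in pimg_from _ _ _ X _]rE IHw ?addSnnS //=; ring.
Qed.

(** The loss time enters only through the tests [t < tl], which all hold on steps that precede both
    loss times. *)
Lemma pimg_from_loss tl tl' t z w : (t + size w <= tl)%N ->
  (t + size w <= tl')%N -> pimg_from pi tl t z w = pimg_from pi tl' t z w.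
Proof.
elim: w t z => [|r w IHw] t z //=; rewrite -addSnnS => le_tl le_tl'.
have lt_t := leq_trans (leq_addr _ _) le_tl.
have lt_t' := leq_trans (leq_addr _ _) le_tl'.
by rewrite (IHw t.+1) // /state_fac /act_fac lt_t lt_t'.
Qed.

Lemma pimg_loss tl tl' w : (size w <= tl)%N -> (size w <= tl')%N ->
  pimg pi tl w = pimg pi tl' w.
Proof.
case: w => [|r w] //= lt_t lt_t'.
have lt0 := leq_ltn_trans (leq0n _) lt_t.
have lt0' := leq_ltn_trans (leq0n _) lt_t'.
by rewrite (@pimg_from_loss tl tl' 1) // /act_fac lt0 lt0'.
Qed.

(** Given the common history, the views are independent continuations with the full-communication
    law. Loss at time 0 is the case of an empty history. *)
Lemma pimg_cat tl wh ws : size wh = tl ->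
  pimg pi tl (wh ++ ws) =
  (synced wh)%:R * pfull pi (sI G) (realize wh) *
    \prod_i pcont (realize wh) (view i ws).
Proof.
case: wh => [|r wh] /= def_tl.
  rewrite !mul1r -def_tl /pimg; case: ws => [|r ws] /=; first by rewrite big1.
  rewrite pimg_from_img // act_fac_img //.
  have -> : [forall i, (r i).1 == sI G]%:R = \prod_i ((r i).1 == sI G)%:R :> R.
    case: forallP => [H|/forallP]; first by rewrite big1 // => i _; rewrite H.
    by rewrite negb_forall => /existsP[i /negPf Hi]; rewrite (bigD1 i) //= Hi mul0r.
  by rewrite -!big_split; apply: eq_bigr => i _; case: (r i).
have lt0 : (0 < tl)%N by rewrite -def_tl.
rewrite act_fac_full // synced_cons.
case: eqP => [rE|_]; last by rewrite /= !(mul0r, mulr0).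
rewrite [X in pimg_from _ _ _ X _]rE pimg_from_cat //=.
have -> : [forall i, (r i).1 == sI G] = (rstate r == sI G).
  apply/forallP/eqP => [H|H i]; last by rewrite rE ffunE /= H.
  by apply/ffunP => i; rewrite ffunE (eqP (H i)).
ring.
Qed.

End Play.

(** * Agent marginals and the factorized law of imaginary play *)

Section Marginals.
Variables (N : nat) (R : realType) (G : game N R) (pi : JS G -> JA G -> R).
Hypotheses (hK : is_kernel G) (hpi : is_policy pi).
Local Notation Z := (JS G * JA G)%type.
Implicit Types (h s u : seq Z) (w : seq (Rec G)).

Lemma sum_synced n (F : seq (Rec G) -> R) :
  \sum_(w : n.-tuple (Rec G) | synced w) F w =
  \sum_(h : n.-tuple Z) F (map (@diag _ _ G) h).
Proof.
rewrite (reindex_onto (map_tuple (@diag _ _ G))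
           (map_tuple (fun r => (rstate r, ract r)))) /=.
  apply: eq_bigl => h; rewrite /synced realize_diag eqxx /=.
  by apply/eqP/val_inj; apply: realize_diag.
by move=> w /eqP def_w; apply: val_inj; rewrite /= [RHS]def_w.
Qed.

(** Only diagonal histories have nonzero weight, so the sum over records before the loss becomes one
    over joint paths. *)
Lemma sum_pimg_cat tl k (F : seq (Rec G) -> R) :
  \sum_(w : (tl + k).-tuple (Rec G)) pimg pi tl w * F w =
  \sum_(h : tl.-tuple Z) pfull pi (sI G) h *
     \sum_(w : k.-tuple (Rec G))
        (\prod_i pcont pi h (view i w)) * F (map (@diag _ _ G) h ++ w).
Proof.
rewrite (sum_tuple_cat tl k (fun w => pimg pi tl w * F w)).
pose E w := pfull pi (sI G) (realize w) * \sum_(w' : k.-tuple (Rec G))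
  (\prod_i pcont pi (realize w) (view i w')) * F (w ++ w').
transitivity (\sum_(w : tl.-tuple (Rec G) | synced w) E w).
  rewrite [RHS]big_mkcond; apply: eq_bigr => w _ /=.
  under eq_bigr => w' _ do rewrite pimg_cat ?size_tuple //.
  case: (synced w); last by rewrite big1 // => w' _; rewrite !mul0r.
  by rewrite /E mulr_sumr; apply: eq_bigr => w' _; rewrite mul1r mulrA.
rewrite sum_synced; apply: eq_bigr => h _.
by rewrite /E realize_diag.
Qed.

Lemma sum_pcont_view h k :
  \sum_(w : k.-tuple (Rec G)) \prod_i pcont pi h (view i w) = 1.
Proof.
have /= := sum_tuple_ffun_prod k (fun=> predT) (fun _ : 'I_N => pcont pi h).
rewrite [X in _ = X -> _]big1 => [H|i _]; last exact: sum_pcont.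
by rewrite -[RHS]H; apply: eq_bigl => w; apply/esym/forallP.
Qed.

Lemma sum_pimg tl n : \sum_(w : n.-tuple (Rec G)) pimg pi tl w = 1.
Proof.
(* Horizons that reach the loss time suffice: on a shorter one the loss time can be replaced by the
   horizon. *)
suff sum1 t k : \sum_(w : (t + k).-tuple (Rec G)) pimg pi t w = 1.
  have [/subnKC <- //|/ltnW le_n] := leqP tl n.
  rewrite -[RHS](sum1 n 0) addn0; apply: eq_bigr => w _.
  by apply: pimg_loss; rewrite size_tuple.
under eq_bigr => w _ do rewrite -[pimg pi t w]mulr1.
rewrite (sum_pimg_cat t k (fun=> 1)) -[RHS](sum_pfull hK hpi t (sI G)).
apply: eq_bigr => h _; under eq_bigr => w _ do rewrite mulr1.
by rewrite sum_pcont_view mulr1.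
Qed.

Lemma pimg_ge0 tl w : 0 <= pimg pi tl w.
Proof.
have ge0 wh ws t : size wh = t -> 0 <= pimg pi t (wh ++ ws).
  move/pimg_cat->; rewrite mulr_ge0 ?mulr_ge0 ?pfull_ge0 //.
  by apply: prodr_ge0 => i _; apply: pcont_ge0.
have [le_tl|/ltnW le_w] := leqP tl (size w).
  by rewrite -(cat_take_drop tl w) ge0 ?size_takel.
by rewrite (@pimg_loss _ _ _ pi tl (size w)) // -[w]cats0 ge0 // cats0.
Qed.

Definition own (i : 'I_N) (z : Z) : st G i * ac G i := (z.1 i, z.2 i).

Lemma own_inj s u : size s = size u ->
  (forall i, map (own i) s = map (own i) u) -> s = u.
Proof.
elim: s u => [|[x a] s IHs] [|[y b] u] //= [eq_sz] eq_own.
congr (_ :: _); last by apply: IHs => // i; case: (eq_own i).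
by congr pair; apply/ffunP => i; case: (eq_own i).
Qed.

Lemma map_own_view i w : map (own i) (view i w) = map (own i) (realize w).
Proof.
by rewrite -!map_comp; apply: eq_map => r; rewrite /= /own /= !ffunE.
Qed.

(** The realized path is read off each agent's own components of its own view. The event thus
    becomes one condition per view, which lets sums factor over agents. *)
Lemma realize_eqE w u : size w = size u ->
  (realize w == u) = [forall i, map (own i) (view i w) == map (own i) u].
Proof.
move=> eq_sz; apply/eqP/forallP => [<- i|H]; first by rewrite map_own_view.
apply: own_inj => [|i]; first by rewrite size_map.
by rewrite -map_own_view; apply/eqP.
Qed.

(* Law of the next [k] steps of agent [i], given the joint history [h]. *)
Definition marg k i h (y : seq (st G i * ac G i)) : R :=
  \sum_(s : k.-tuple Z | map (own i) s == y) pcont pi h s.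

(** Moving the loss to the horizon [n] leaves an empty continuation after it, so only the diagonal
    copy of [u] contributes. *)
Lemma pimg_prefix_short tl n (u : n.-tuple Z) : (n <= tl)%N ->
  pimg_prefix pi tl u = pfull pi (sI G) u.
Proof.
move=> le_n; rewrite /pimg_prefix big_mkcond.
have -> : \sum_(w : n.-tuple (Rec G)) (if realize w == u then pimg pi tl w else 0) =
    \sum_(w : (n + 0).-tuple (Rec G)) pimg pi n w * (realize w == u)%:R.
  rewrite addn0; apply: eq_bigr => w _.
  rewrite (@pimg_loss _ _ _ pi tl n) ?size_tuple //.
  by case: eqP; rewrite (mulr1, mulr0).
rewrite (sum_pimg_cat n 0 (fun w => (realize w == u)%:R)).
rewrite (bigD1 u) //= [X in _ + X]big1 ?addr0 => [|h ne_h].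
  rewrite (sum_tuple0 (fun w => (\prod_i pcont pi u (view i w)) *
    (realize (map (@diag _ _ G) u ++ w) == u)%:R)).
  by rewrite cats0 realize_diag eqxx mulr1 big1 ?mulr1 // => i _; case: (tval u).
rewrite big1 ?mulr0 // => w _; rewrite (size0nil (size_tuple w)) cats0.
by rewrite realize_diag val_eqE (negPf ne_h) mulr0.
Qed.

(** Given [h], the views are independent and the constraint splits by agent; summing out the
    imagined teammates leaves the marginal of agent [i]. *)
Lemma pimg_prefix_cat tl k (h : tl.-tuple Z) (s : k.-tuple Z) :
  \sum_(w : (tl + k).-tuple (Rec G) | realize w == h ++ s) pimg pi tl w =
  pfull pi (sI G) h * \prod_i marg k h (map (own i) s).
Proof.
rewrite big_mkcond.
under eq_bigr => w _.
  have -> : (if realize w == h ++ s then pimg pi tl w else 0) =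
    pimg pi tl w * (realize w == h ++ s)%:R.
    by case: eqP; rewrite (mulr1, mulr0).
  over.
rewrite (sum_pimg_cat tl k (fun w => (realize w == h ++ s)%:R)).
have realizeE (h' : tl.-tuple Z) (w : k.-tuple (Rec G)) :
    (realize (map (@diag _ _ G) h' ++ w) == h ++ s) = (h' == h) && (realize w == s).
  by rewrite {1}/realize map_cat -/(realize _) realize_diag eqseq_cat ?size_tuple.
rewrite (bigD1 h) //= [X in _ + X]big1 ?addr0 => [|h' /negPf ne_h].
  congr (_ * _).
  have <- := sum_tuple_ffun_prod k
    (fun i s' => map (own i) s' == map (own i) s) (fun=> pcont pi h).
  rewrite [RHS]big_mkcond; apply: eq_bigr => w _.
  rewrite realizeE eqxx /= realize_eqE ?size_tuple //.
  by case: ifP; rewrite (mulr1, mulr0).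
by rewrite big1 ?mulr0 // => w _; rewrite realizeE ne_h mulr0.
Qed.

End Marginals.

(** * Jensen's inequality and the Bretagnolle-Huber bound *)

Section Divergence.
Variables (R : realType) (T : finType).
Implicit Types (P Q g rho : T -> R) (A : pred T).

Lemma ln_le_subr1 (x : R) : 0 < x -> ln x <= x - 1.
Proof. by move=> x0; have := expR_ge1Dx (ln x); rewrite lnK ?posrE //; lra. Qed.

(** Jensen's inequality for the logarithm, obtained by averaging [ln r <= r - 1] over the support of
    [P]. *)
Lemma sum_ln_le0 P rho : (forall x, 0 <= P x) -> \sum_x P x = 1 ->
  (forall x, P x != 0 -> 0 < rho x) -> \sum_(x | P x != 0) P x * rho x <= 1 ->
  \sum_(x | P x != 0) P x * ln (rho x) <= 0.
Proof.
move=> P0 P1 rho0 rho1.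
have sumP : \sum_(x | P x != 0) P x = 1.
  by rewrite -P1 [RHS](bigID (fun x => P x != 0)) /= [X in _ + X]big1 ?addr0 // =>
    x /negPn/eqP.
apply: (@le_trans _ _ (\sum_(x | P x != 0) (P x * rho x - P x))).
  apply: ler_sum => x Px; rewrite -[X in _ - X]mulr1 -mulrBr.
  by apply: ler_wpM2l; [apply: P0 | apply/ln_le_subr1/rho0].
by rewrite sumrB sumP; lra.
Qed.

(** Jensen's inequality for an unnormalized [g]: [sum_ln_le0] is applied to [g x / P x / S], whose
    mean is 1. *)
Lemma expR_sum_ln_le P g : (forall x, 0 <= P x) -> \sum_x P x = 1 ->
  (forall x, P x != 0 -> 0 < g x) ->
  expR (\sum_(x | P x != 0) P x * ln (g x / P x)) <= \sum_(x | P x != 0) g x.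
Proof.
move=> P0 P1 g0; set S := \sum_(x | _) g x.
have sumP : \sum_(x | P x != 0) P x = 1.
  by rewrite -P1 [RHS](bigID (fun x => P x != 0)) /= [X in _ + X]big1 ?addr0 // =>
    x /negPn/eqP.
have Ppos x : P x != 0 -> 0 < P x by rewrite lt_def P0 andbT.
have S0 : 0 < S.
  rewrite /S lt_def sumr_ge0 ?andbT => [|x /g0/ltW //].
  apply/eqP => /psumr_eq0P g_eq0.
  move: sumP; rewrite big1 => [/eqP|x Px]; first by rewrite eq_sym oner_eq0.
  by have := g0 x Px; rewrite g_eq0 ?ltxx // => y /g0/ltW.
rewrite -[leRHS]lnK ?posrE // ler_expR -subr_le0.
have -> : ln S = \sum_(x | P x != 0) P x * ln S.
  by rewrite -mulr_suml sumP mul1r.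
rewrite -sumrB.
under eq_bigr => x Px.
  rewrite -mulrBr -ln_div ?posrE ?divr_gt0 ?g0 ?Ppos //; over.
apply: sum_ln_le0 => // [x Px|]; first by rewrite !divr_gt0 ?g0 ?Ppos.
rewrite (eq_bigr (fun x => g x / S)) => [|x Px].
  by rewrite -mulr_suml divff // gt_eqF.
by rewrite mulrA [_ * (_ / _)]mulrC divfK.
Qed.

(* Q P is the product of g1 (Q on A, P off A) and g2 (P on A, Q off A), whose
   total masses are at most 1 - d and 1 + d. *)
Lemma bretagnolle_huber P Q A :
  (forall x, 0 <= P x) -> (forall x, 0 <= Q x) ->
  \sum_x P x = 1 -> \sum_x Q x = 1 -> (forall x, P x != 0 -> 0 < Q x) ->
  \sum_(x | A x) P x - \sum_(x | A x) Q x <=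
    Num.sqrt (1 - expR (- \sum_(x | P x != 0) P x * ln (P x / Q x))).
Proof.
move=> P0 Q0 P1 Q1 Qpos; set d := _ - _.
have Ppos x : P x != 0 -> 0 < P x by rewrite lt_def P0 andbT.
pose g1 x := if A x then Q x else P x; pose g2 x := if A x then P x else Q x.
have sum_g (g : T -> R) : (forall x, 0 <= g x) ->
    \sum_(x | P x != 0) g x <= \sum_x g x.
  by move=> g0; rewrite [leRHS](bigID (fun x => P x != 0)) /= lerDl sumr_ge0.
have PA : \sum_(x | A x) P x + \sum_(x | ~~ A x) P x = 1 by rewrite -P1 [RHS](bigID A).
have QA : \sum_(x | A x) Q x + \sum_(x | ~~ A x) Q x = 1 by rewrite -Q1 [RHS](bigID A).
have g1_sum : \sum_x g1 x = 1 - d.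
  rewrite (bigID A) /= (eq_bigr Q) => [|x]; last by rewrite /g1 => ->.
  rewrite [X in _ + X](eq_bigr P) => [|x /negPf]; last by rewrite /g1 => ->.
  by rewrite /d; lra.
have g2_sum : \sum_x g2 x = 1 + d.
  rewrite (bigID A) /= (eq_bigr P) => [|x]; last by rewrite /g2 => ->.
  rewrite [X in _ + X](eq_bigr Q) => [|x /negPf]; last by rewrite /g2 => ->.
  by rewrite /d; lra.
have g1_ge0 x : 0 <= g1 x by rewrite /g1; case: ifP.
have g2_ge0 x : 0 <= g2 x by rewrite /g2; case: ifP.
have g1_gt0 x : P x != 0 -> 0 < g1 x.
  by rewrite /g1; case: ifP => _ Px; rewrite ?Ppos ?Qpos.
have g2_gt0 x : P x != 0 -> 0 < g2 x.
  by rewrite /g2; case: ifP => _ Px; rewrite ?Ppos ?Qpos.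
have [d0|d0] := leP d 0; first by rewrite (le_trans d0) // sqrtr_ge0.
suff le_d2 : d ^+ 2 <= 1 - expR (- \sum_(x | P x != 0) P x * ln (P x / Q x)).
  by apply: le_trans (ler_wsqrtr le_d2); rewrite sqrtr_sqr ler_norm.
rewrite lerBrDr -lerBrDl.
have -> : - \sum_(x | P x != 0) P x * ln (P x / Q x) =
    \sum_(x | P x != 0) P x * ln (g1 x / P x) +
    \sum_(x | P x != 0) P x * ln (g2 x / P x).
  rewrite -big_split -sumrN; apply: eq_bigr => x Px /=.
  rewrite -mulrDr -lnM ?posrE ?divr_gt0 ?g1_gt0 ?g2_gt0 ?Ppos //.
  rewrite -mulrN -lnV ?posrE ?divr_gt0 ?Qpos ?Ppos //; congr (_ * ln _).
  have Qx : Q x != 0 by rewrite gt_eqF ?Qpos.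
  by rewrite /g1 /g2; case: ifP => _; field; rewrite Px Qx.
rewrite expRD -[X in _ <= X - _](expr1n _ 2) subr_sqr.
apply: ler_pM; rewrite ?expR_ge0 //.
  by rewrite -g1_sum; apply: le_trans (expR_sum_ln_le P0 P1 g1_gt0) (sum_g _ _).
by rewrite -g2_sum; apply: le_trans (expR_sum_ln_le P0 P1 g2_gt0) (sum_g _ _).
Qed.

End Divergence.

(** * Comparison of loss times through ratios of path laws *)

Section TotalCorrelation.
Variables (N : nat) (R : realType) (G : game N R) (pi : JS G -> JA G -> R).
Hypotheses (hK : is_kernel G) (hpi : is_policy pi).
Local Notation Z := (JS G * JA G)%type.
Implicit Types (h s u : seq Z).

Lemma ln_prod (I : finType) (f : I -> R) : (forall i, 0 < f i) ->
  ln (\prod_i f i) = \sum_i ln (f i).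
Proof.
move=> f0; suff [] : 0 < \prod_i f i /\ ln (\prod_i f i) = \sum_i ln (f i) by [].
elim/big_rec2: _ => [|i x y _ [x0 <-]]; first by rewrite ln1.
by rewrite mulr_gt0 ?f0 // lnM ?posrE ?f0.
Qed.

(* Equality unless [x = 0], where the quotient is 0. *)
Lemma divff_le1 (x : R) : x / x <= 1.
Proof.
by have [->|/divff->] := eqVneq x 0; rewrite ?mul0r ?ler01.
Qed.

Lemma marg_ge0 k i h (y : seq (st G i * ac G i)) : 0 <= marg pi k h y.
Proof. by apply: sumr_ge0 => s _; apply: pcont_ge0. Qed.

Lemma pcont_le_marg k i h (s : k.-tuple Z) :
  pcont pi h s <= marg pi k h (map (own i) s).
Proof.
rewrite /marg (bigD1 s) //= lerDl.
by apply: sumr_ge0 => s' _; apply: pcont_ge0.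
Qed.

(** Consistency of the marginals: the last [k] steps can be summed out because continuations have
    total mass 1. *)
Lemma sum_marg_cat tl k i (y : tl.-tuple (st G i * ac G i)) :
  \sum_(y' : k.-tuple (st G i * ac G i)) marg pi (tl + k) [::] (y ++ y') =
  marg pi tl [::] y.
Proof.
rewrite /marg (exchange_big_dep predT) //= [RHS]big_mkcond /=.
pose F (u : seq Z) := \sum_(y' : k.-tuple (st G i * ac G i) |
  map (own i) u == y ++ y') pfull pi (sI G) u.
rewrite (sum_tuple_cat tl k F); apply: eq_bigr => h _.
transitivity (\sum_(s : k.-tuple Z) (if map (own i) h == y
    then pfull pi (sI G) h * pcont pi h s else 0)).
  apply: eq_bigr => s _; rewrite /F map_cat pfull_cat.
  under eq_bigl => y' do rewrite eqseq_cat ?size_map ?size_tuple //.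
  case: ifP => _; last by rewrite big_pred0.
  by rewrite (big_pred1 (map_tuple (own i) s)) // => y'; rewrite /= eq_sym.
case: ifP => _; last by rewrite big1.
by rewrite -mulr_sumr sum_pcont // mulr1.
Qed.

(* [pimg_prefix] on sequences, so that concatenations need no cast. *)
Definition img_prefix n tl u : R :=
  \sum_(w : n.-tuple (Rec G) | realize w == u) pimg pi tl w.

(** With an empty common history the agents are independent from the start, each with its
    full-communication marginal. *)
Lemma img_prefix0 n (u : n.-tuple Z) :
  img_prefix n 0 u = \prod_i marg pi n [::] (map (own i) u).
Proof. by have /= := pimg_prefix_cat pi [tuple] u; rewrite mul1r. Qed.

Lemma sum_img_prefix n tl (A : pred (seq Z)) :
  \sum_(u : n.-tuple Z | A u) img_prefix n tl u =
  \sum_(w : n.-tuple (Rec G) | A (realize w)) pimg pi tl w.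
Proof.
rewrite (partition_big (map_tuple (fun r => (rstate r, ract r))) A) //=.
apply: eq_bigr => u Au; apply: eq_bigl => w.
rewrite -val_eqE /= -/(realize w).
by apply/idP/andP => [|[]//] /eqP ->.
Qed.

Section Comparison.
Variables tl k : nat.

(** A pair is a path cut at the loss time and [P] is its full-communication law. Below, [m0], [m]
    and [M] are the marginals of agent [i] for the history, for the continuation given the joint
    history, and for the whole path. *)
Let P (x : tl.-tuple Z * k.-tuple Z) : R :=
  pfull pi (sI G) x.1 * pcont pi x.1 x.2.

Let m0 i (x : tl.-tuple Z * k.-tuple Z) : R :=
  marg pi tl [::] (map (own i) x.1).

Let m i (x : tl.-tuple Z * k.-tuple Z) : R :=
  marg pi k x.1 (map (own i) x.2).

Let M i (x : tl.-tuple Z * k.-tuple Z) : R :=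
  marg pi (tl + k) [::] (map (own i) (x.1 ++ x.2)).

(** The law for loss time 0 divided by that for loss time [tl] is [prefix_ratio] times the product
    of all [cont_ratio i]. *)
Let prefix_ratio x := (\prod_i m0 i x) / pfull pi (sI G) x.1.
Let cont_ratio i x := M i x / (m0 i x * m i x).

Let sum_pairs (F : tl.-tuple Z * k.-tuple Z -> R) :
  \sum_x F x = \sum_(h : tl.-tuple Z) \sum_(s : k.-tuple Z) F (h, s).
Proof. by rewrite pair_big /=; apply: eq_bigr => -[]. Qed.

Let P_ge0 x : 0 <= P x.
Proof. by rewrite mulr_ge0 ?pfull_ge0 ?pcont_ge0. Qed.

Let sum_P : \sum_x P x = 1.
Proof.
rewrite sum_pairs.
rewrite -(sum_pfull hK hpi tl (sI G)); apply: eq_bigr => h _.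
by rewrite -mulr_sumr sum_pcont // mulr1.
Qed.

(** On the support, [P x * prefix_ratio x] is the loss-time 0 law of the history times [pcont], and
    this product has total mass 1. *)
Let mean_prefix_ratio : \sum_(x | P x != 0) P x * prefix_ratio x <= 1.
Proof.
pose F (x : tl.-tuple Z * k.-tuple Z) := img_prefix tl 0 x.1 * pcont pi x.1 x.2.
have F_ge0 x : 0 <= F x.
  by rewrite mulr_ge0 ?pcont_ge0 // sumr_ge0 // => w _; apply: pimg_ge0.
apply: (@le_trans _ _ (\sum_x F x)).
  rewrite [leRHS](bigID (fun x => P x != 0)) /= -[leLHS]addr0.
  apply: lerD; last by apply: sumr_ge0.
  apply: ler_sum => x; rewrite mulf_eq0 negb_or => /andP[h0 _].
  by rewrite /P /prefix_ratio /F img_prefix0 [_ / _]mulrC mulrACA divff // mul1r mulrC.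
rewrite sum_pairs.
rewrite -[leRHS](sum_pimg hK hpi 0 tl) -(sum_img_prefix tl 0 predT).
apply: ler_sum => h _.
by rewrite /F /= -mulr_sumr sum_pcont // mulr1.
Qed.

(** For fixed [h], grouping the continuations by agent [i]'s own part cancels [m]; the remaining sum
    of [M] cancels [m0] by consistency. A zero denominator gives 0 instead of 1, hence the
    inequality. *)
Let mean_cont_ratio i : \sum_(x | P x != 0) P x * cont_ratio i x <= 1.
Proof.
have -> : \sum_(x | P x != 0) P x * cont_ratio i x = \sum_x P x * cont_ratio i x.
  rewrite big_mkcond; apply: eq_bigr => x _.
  by case: eqP => [->|]; rewrite ?mul0r.
rewrite sum_pairs.
rewrite -(sum_pfull hK hpi tl (sI G)); apply: ler_sum => h _.
have pf := pfull_ge0 hK hpi (sI G) h.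
set y := map_tuple (own i) h.
have m0_ge0 : 0 <= marg pi tl [::] y by apply: marg_ge0.
apply: (@le_trans _ _ (pfull pi (sI G) h *
    ((marg pi tl [::] y)^-1 * marg pi tl [::] y))); last first.
  by rewrite ler_piMr // mulrC divff_le1.
rewrite -[X in _ * (_ * X)](sum_marg_cat k).
pose K (s : k.-tuple Z) := pcont pi h s * M i (h, s) / m i (h, s).
have -> : \sum_(s : k.-tuple Z) P (h, s) * cont_ratio i (h, s) =
    pfull pi (sI G) h * ((marg pi tl [::] y)^-1 * \sum_(s : k.-tuple Z) K s).
  rewrite !mulr_sumr; apply: eq_bigr => s _.
  by rewrite /P /cont_ratio /K /m0 /= invfM; ring.
apply: ler_wpM2l => //; apply: ler_wpM2l; first by rewrite invr_ge0.
rewrite (partition_big (map_tuple (own i)) predT) //=.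
apply: ler_sum => y' _.
have KE (s : k.-tuple Z) : map_tuple (own i) s == y' ->
    K s = pcont pi h s * (marg pi (tl + k) [::] (y ++ y') / marg pi k h y').
  by move=> /eqP <-; rewrite /K /M /m map_cat mulrA.
rewrite (eq_bigr _ KE) -mulr_suml.
have -> : \sum_(s : k.-tuple Z | map_tuple (own i) s == y') pcont pi h s =
   marg pi k h y' by [].
by rewrite mulrCA ler_piMr ?marg_ge0 // divff_le1.
Qed.

(** The left side is the divergence of the full law from loss time [tl] minus that from loss time 0.
    The logarithm splits into those of [prefix_ratio] and of the [cont_ratio i], each of nonpositive
    mean. *)
Lemma sum_ln_img_ratio_le0 :
  \sum_(u : (tl + k).-tuple Z | pfull pi (sI G) u != 0)
    pfull pi (sI G) u * ln (img_prefix (tl + k) 0 u / img_prefix (tl + k) tl u)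
  <= 0.
Proof.
pose F u := if pfull pi (sI G) u != 0 then pfull pi (sI G) u *
  ln (img_prefix (tl + k) 0 u / img_prefix (tl + k) tl u) else 0.
rewrite big_mkcond (sum_tuple_cat tl k F) pair_big /=.
have gt0 x : P x != 0 ->
    [/\ 0 < pfull pi (sI G) x.1, forall i, 0 < m0 i x,
        forall i, 0 < m i x & forall i, 0 < M i x].
  move=> Px; have Ppos : 0 < P x by rewrite lt_def Px P_ge0.
  have [h0 c0] : 0 < pfull pi (sI G) x.1 /\ 0 < pcont pi x.1 x.2.
    move: Px; rewrite mulf_eq0 negb_or !lt_def pfull_ge0 // pcont_ge0 //.
    by rewrite !andbT => /andP[].
  split=> // i.
  - exact: lt_le_trans h0 (pcont_le_marg i [::] x.1).
  - exact: lt_le_trans c0 (pcont_le_marg i x.1 x.2).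
  apply: lt_le_trans Ppos _; rewrite /P -pfull_cat.
  exact: (pcont_le_marg i [::] (cat_tuple x.1 x.2)).
have rho1_gt0 x : P x != 0 -> 0 < prefix_ratio x.
  move=> /gt0[h0 m0_gt0 _ _]; rewrite divr_gt0 //.
  by apply: prodr_gt0 => i _; apply: m0_gt0.
have rho2_gt0 i x : P x != 0 -> 0 < cont_ratio i x.
  by move=> /gt0[_ m0_gt0 m_gt0 M_gt0]; rewrite divr_gt0 ?mulr_gt0.
have -> : \sum_(x : tl.-tuple Z * k.-tuple Z) F (x.1 ++ x.2) =
    \sum_(x | P x != 0) P x * ln (prefix_ratio x)
    + \sum_i \sum_(x | P x != 0) P x * ln (cont_ratio i x).
  rewrite [X in _ + X]exchange_big -big_split [RHS]big_mkcond /=.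
  apply: eq_bigr => -[h s] _ /=; rewrite /F pfull_cat -/(P (h, s)).
  case: ifP => // Px; have [h0 m0_gt0 m_gt0 M_gt0] := gt0 _ Px.
  rewrite -mulr_sumr -mulrDr -ln_prod => [|i]; last exact: rho2_gt0.
  rewrite -lnM ?posrE ?rho1_gt0 //; last first.
    by apply: prodr_gt0 => i _; apply: rho2_gt0.
  congr (_ * ln _); rewrite /img_prefix pimg_prefix_cat // -/(img_prefix _ _ _).
  rewrite (img_prefix0 (cat_tuple h s)) /prefix_ratio /cont_ratio big_split /=.
  rewrite prodfV big_split /= -/(\prod_i m i (h, s)).
  have m0_neq0 : \prod_i m0 i (h, s) != 0.
    by rewrite gt_eqF // prodr_gt0 // => i _; apply: m0_gt0.
  have m_neq0 : \prod_i m i (h, s) != 0.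
    by rewrite gt_eqF // prodr_gt0 // => i _; apply: m_gt0.
  have h_neq0 : pfull pi (sI G) h != 0 by rewrite gt_eqF.
  rewrite /m /= in m_neq0 *; rewrite /M /=.
  by field; rewrite m0_neq0 m_neq0 h_neq0.
rewrite -[leRHS]addr0 lerD //; first exact: sum_ln_le0.
by apply: sumr_le0 => i _; apply: sum_ln_le0 => // x; apply: rho2_gt0.
Qed.

End Comparison.

End TotalCorrelation.

(** * A divergence bound uniform in the loss time *)

Section LossBound.
Variables (N : nat) (R : realType) (G : game N R) (pi : JS G -> JA G -> R).
Hypotheses (hK : is_kernel G) (hpi : is_policy pi).
Local Notation Z := (JS G * JA G)%type.
Local Notation full := (pfull pi (sI G)).

Lemma img_prefix_short n tl (u : n.-tuple Z) : (n <= tl)%N ->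
  img_prefix pi n tl u = full u.
Proof. exact: pimg_prefix_short. Qed.

Lemma img_prefix_ge0 n tl (u : seq Z) : 0 <= img_prefix pi n tl u.
Proof. by apply: sumr_ge0 => w _; apply: pimg_ge0. Qed.

(** Absolute continuity: each agent's marginal is at least the joint probability of the
    continuation. *)
Lemma img_prefix_gt0 n tl (u : n.-tuple Z) : full u != 0 ->
  0 < img_prefix pi n tl u.
Proof.
move=> u0; have [le_n|lt_tl] := leqP n tl.
  by rewrite img_prefix_short // lt_def u0 pfull_ge0.
move: (n - tl)%N (subnKC (ltnW lt_tl)) => k def_n.
case: n / def_n u u0 lt_tl => u u0 _.
have h_sz : size (take tl u) == tl by rewrite size_takel // size_tuple leq_addr.
have s_sz : size (drop tl u) == k by rewrite size_drop size_tuple addKn.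
move: u0; rewrite -(cat_take_drop tl u) pfull_cat mulf_eq0 negb_or => /andP[h0 s0].
rewrite /img_prefix (pimg_prefix_cat pi (Tuple h_sz) (Tuple s_sz)).
rewrite mulr_gt0 //= ?lt_def ?h0 ?pfull_ge0 // -lt_def prodr_gt0 // => i _.
apply: lt_le_trans (pcont_le_marg hK hpi i (take tl u) (Tuple s_sz)).
by rewrite /= lt_def s0 pcont_ge0.
Qed.

(** The Kullback-Leibler divergence at horizon [n], taken as a real number because [img_prefix_gt0]
    keeps it finite. *)
Definition img_div n tl : R :=
  \sum_(u : n.-tuple Z | full u != 0) full u * ln (full u / img_prefix pi n tl u).

Lemma img_div_le n tl : img_div n tl <= img_div n 0.
Proof.
suff le_div k t : img_div (t + k) t <= img_div (t + k) 0.
  (* When the loss comes after the horizon, loss time [n] gives the same law, which is the case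
     [k = 0]. *)
  have [/subnKC <- //|/ltnW le_n] := leqP tl n.
  apply: le_trans (_ : img_div n n <= _); last by have := le_div 0 n; rewrite addn0.
  rewrite le_eqVlt; apply/orP; left; apply/eqP; apply: eq_bigr => u _.
  by rewrite !img_prefix_short.
rewrite -subr_ge0 -oppr_le0 opprB -sumrB.
apply: le_trans (sum_ln_img_ratio_le0 hK hpi t k); apply: ler_sum => u u0.
have fu0 : 0 < full u by rewrite lt_def u0 pfull_ge0.
rewrite -mulrBr !ln_div ?posrE ?img_prefix_gt0 //.
by apply: ler_wpM2l; [exact: ltW | lra].
Qed.

Lemma img_div_le_C_pi n r : C_pi pi = r%:E -> img_div n 0 <= r.
Proof.
move=> C_r; rewrite -lee_fin -C_r; apply: le_ereal_sup_tmp.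
exists (KL (fun u : n.-tuple Z => full u) (pimg_prefix pi 0 (T:=n))); first by exists n.
rewrite /KL /img_div big_mkcond -sumEFin; apply: lee_sum => u _.
case: eqP => [//|/eqP u0] /=.
by have := img_prefix_gt0 0 u0; rewrite /img_prefix -/(pimg_prefix _ _ _) => /gt_eqF ->.
Qed.

End LossBound.

(** * Suprema over horizons and geometric decay *)

Section SupNat.
Variable R : realType.
Implicit Types (f : nat -> R) (b : R).

Lemma le_sup_nat f b n : (forall n, f n <= b) ->
  f n <= sup [set r | exists T, r = f T].
Proof.
move=> fb; apply: sup_upper_bound; last by exists n.
by split; [exists (f 0); exists 0 | exists b => _ [T ->]].
Qed.

Lemma sup_nat_le f b : (forall n, f n <= b) ->
  sup [set r | exists T, r = f T] <= b.
Proof. by move=> fb; apply: ge_sup; [exists (f 0); exists 0 | move=> _ [T ->]]. Qed.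

Lemma sup_nat_approx f b (e : R) : 0 < e -> (forall n, f n <= b) ->
  exists n, sup [set r | exists T, r = f T] - e < f n.
Proof.
move=> e0 fb.
have [|_ [n ->]] := @sup_adherent _ [set r | exists T, r = f T] _ e0.
  by split; [exists (f 0); exists 0 | exists b => _ [T ->]].
by exists n.
Qed.

Lemma sum_ltn n m : (\sum_(k < n) (k < m) = minn m n)%N.
Proof.
elim: n => [|n IHn]; first by rewrite big_ord0 minn0.
rewrite big_ord_recr /= IHn; have [lt_n|le_m] := ltnP n m.
  by rewrite (minn_idPr lt_n) addn1.
by rewrite (minn_idPl (leqW le_m)) addn0.
Qed.

(** A form of Bernoulli's inequality, [(1 - p) ^+ n * (1 + n * p) <= 1], forces the power below [e]
    once [n * p * e > 1]. *)
Lemma expr_small (p e : R) : 0 < p <= 1 -> 0 < e ->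
  exists n0, forall n, (n0 <= n)%N -> (1 - p) ^+ n <= e.
Proof.
move=> /andP[p0 p1] e0.
have bern n : (1 - p) ^+ n * (1 + n%:R * p) <= 1.
  elim: n => [|n IHn]; first by rewrite expr0 mul0r addr0 mulr1.
  apply: le_trans IHn; rewrite exprSr -mulrA; apply: ler_wpM2l.
    by rewrite exprn_ge0 // subr_ge0.
  have := mulr_ge0 (ler0n R n) (sqr_ge0 p); have := sqr_ge0 p.
  by rewrite -natr1; nra.
exists (Num.bound (1 / (e * p))) => n le_n.
have : 1 / (e * p) < n%:R.
  apply: lt_le_trans (_ : (Num.bound (1 / (e * p)))%:R <= _); last by rewrite ler_nat.
  by apply: archi_boundP; rewrite divr_ge0 // mulr_ge0 ?ltW.
rewrite ltr_pdivrMr ?mulr_gt0 // => lt1; rewrite leNgt; apply/negP => lt_e.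
have np0 : 0 <= n%:R * p by rewrite mulr_ge0 // ltW.
have := bern n; have := ler_wpM2r np0 (ltW lt_e).
by move: lt1 lt_e e0; set x := _ ^+ n; nra.
Qed.

End SupNat.

(** * Success within a finite horizon *)

Section ReachAvoid.
Variables (N : nat) (R : realType) (G : game N R) (pi : JS G -> JA G -> R).
Variables ST SA : {set JS G}.
Hypotheses (hK : is_kernel G) (hpi : is_policy pi).
Local Notation Z := (JS G * JA G)%type.
Local Notation full := (pfull pi (sI G)).
Local Notation F := (succ_full_T pi ST SA (sI G)).
Local Notation v := (v_full pi ST SA).
Implicit Types (w : seq Z).

Lemma succP w :
  reflect (exists M, [/\ (M < size w)%N, nth (sI G) (map fst w) M \in ST &
             forall t, (t < M)%N -> nth (sI G) (map fst w) t \notin SA])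
          (succ ST SA w).
Proof.
apply: (iffP hasP) => [[M]|[M [lt_M M_ST M_SA]]].
  rewrite mem_iota add0n => /= lt_M /andP[M_ST /allP M_SA].
  by exists M; split=> // t lt_t; apply: M_SA; rewrite mem_iota.
exists M; first by rewrite mem_iota.
by rewrite M_ST; apply/allP => t; rewrite mem_iota add0n; apply: M_SA.
Qed.

Lemma succ_cat w w' : succ ST SA w -> succ ST SA (w ++ w').
Proof.
move=> /succP[M [lt_M M_ST M_SA]]; apply/succP; exists M.
rewrite size_cat map_cat nth_cat size_map lt_M; split=> //.
  exact: leq_trans lt_M (leq_addr _ _).
by move=> t lt_t; rewrite nth_cat size_map (ltn_trans lt_t lt_M) M_SA.
Qed.

Lemma succ_full_T_ge0 x n : 0 <= succ_full_T pi ST SA x n.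
Proof. by apply: sumr_ge0 => w _; rewrite mulr_ge0 ?pfull_ge0. Qed.

Lemma succ_full_T_le1 x n : succ_full_T pi ST SA x n <= 1.
Proof.
rewrite -(sum_pfull hK hpi n x); apply: ler_sum => w _.
by rewrite ler_piMr ?pfull_ge0 // lern1 leq_b1.
Qed.

Lemma succ_full_T_le x n : succ_full_T pi ST SA x n <= vfull_from pi ST SA x.
Proof. exact: le_sup_nat (succ_full_T_le1 x). Qed.

Lemma v_full_le1 : v <= 1.
Proof. exact: sup_nat_le (succ_full_T_le1 _). Qed.

Definition succ_img tl n : R :=
  \sum_(w : n.-tuple (Rec G)) pimg pi tl w * (succ ST SA (realize w))%:R.

Lemma succ_imgE tl n : succ_img tl n =
  \sum_(u : n.-tuple Z | succ ST SA u) img_prefix pi n tl u.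
Proof.
rewrite sum_img_prefix big_mkcond; apply: eq_bigr => w _.
by case: ifP => _; rewrite (mulr1, mulr0).
Qed.

Lemma succ_img_le1 tl n : succ_img tl n <= 1.
Proof.
rewrite -(sum_pimg hK hpi tl n); apply: ler_sum => w _.
by rewrite ler_piMr ?pimg_ge0 // lern1 leq_b1.
Qed.

Lemma succ_img_le tl n : succ_img tl n <= v_img_at pi ST SA tl.
Proof. exact: le_sup_nat (succ_img_le1 tl). Qed.

Lemma v_img_at_ge0 tl : 0 <= v_img_at pi ST SA tl.
Proof.
apply: le_trans (succ_img_le tl 0).
by apply: sumr_ge0 => w _; rewrite mulr_ge0 ?pimg_ge0.
Qed.

Lemma succ_full_TE n : F n = \sum_(u : n.-tuple Z | succ ST SA u) full u.
Proof.
rewrite [RHS]big_mkcond; apply: eq_bigr => u _.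
by case: ifP => _; rewrite (mulr1, mulr0).
Qed.

(** With loss time [n] the first [n] steps follow full communication. *)
Lemma succ_full_T_le_v_img_at n : F n <= v_img_at pi ST SA n.
Proof.
apply: le_trans (succ_img_le n n); rewrite succ_imgE succ_full_TE le_eqVlt.
apply/orP; left; apply/eqP/eq_bigr => u _.
by rewrite img_prefix_short.
Qed.

(** Bretagnolle-Huber is applied at each horizon, where the divergence is at most [r], before the
    supremum is taken. *)
Lemma v_full_corr tl r : C_pi pi = r%:E ->
  v - Num.sqrt (1 - expR (- r)) <= v_img_at pi ST SA tl.
Proof.
move=> C_r; rewrite lerBlDr; apply: sup_nat_le => n.
rewrite -lerBlDl; apply: le_trans (lerB (lexx _) (succ_img_le tl n)) _.
rewrite succ_imgE -/(F n) succ_full_TE.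
apply: le_trans (bretagnolle_huber _ _ _ _ _ _) _ => //.
- by move=> u; apply: pfull_ge0.
- by move=> u; apply: img_prefix_ge0.
- exact: sum_pfull.
- by rewrite (sum_img_prefix pi n tl predT) sum_pimg.
- by move=> u; apply: img_prefix_gt0.
apply: ler_wsqrtr; rewrite lerD2l lerN2 ler_expR lerN2.
exact: le_trans (img_div_le hK hpi n tl) (img_div_le_C_pi hK hpi n C_r).
Qed.

(** Continuations have total mass 1, so success at different horizons can be compared on one set of
    paths. *)
Lemma succ_full_T_prefix k j :
  F k = \sum_(w : (k + j).-tuple Z) full w * (succ ST SA (take k w))%:R.
Proof.
rewrite (sum_tuple_cat k j (fun w => full w * (succ ST SA (take k w))%:R)).
apply: eq_bigr => h _.
transitivity (\sum_(s : j.-tuple Z) full h * (succ ST SA h)%:R * pcont pi h s).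
  by rewrite -mulr_sumr sum_pcont // mulr1.
apply: eq_bigr => s _; rewrite pfull_cat take_size_cat ?size_tuple //.
by rewrite mulrAC.
Qed.

Lemma succ_full_T_mono : {homo F : k n / (k <= n)%N >-> k <= n}.
Proof.
move=> k n /subnKC <-; rewrite (succ_full_T_prefix k (n - k)); apply: ler_sum => w _.
apply: ler_wpM2l; first exact: pfull_ge0.
rewrite ler_nat -[X in (_ <= succ _ _ X)%N](cat_take_drop k).
by case: (boolP (succ _ _ (take k w))) => // /succ_cat ->.
Qed.

Lemma succ_full_T0 : F 0 = 0.
Proof. by rewrite /succ_full_T (sum_tuple0 (fun w => full w * (succ ST SA w)%:R)) mulr0. Qed.

(** The tail keeps its factors of the path law, except that the factor for entering its first state
    becomes an indicator equal to 1. *)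
Lemma pfull_drop z0 k w : full w != 0 -> (k < size w)%N ->
  pfull pi (nth z0 w k).1 (drop k w) != 0.
Proof.
move=> w0 lt_k; move: w0; rewrite -{1}(cat_take_drop k w) pfull_cat.
rewrite (drop_nth z0 lt_k); case: (nth z0 w k) => x a /=.
rewrite eqxx mul1r mulf_eq0 negb_or => /andP[_].
case: (take k w) => [|z h] /=; rewrite !mulf_eq0 !negb_or -!andbA;
  by case/and3P => _ -> ->.
Qed.

(* A positive-probability successful path does not visit S_D before S_T: from
   S_D the rest of the path, itself successful, would have probability 0. *)
Lemma succ_take w k : full w != 0 -> succ ST SA w ->
  (find (fun s => (s \in ST) || (s \in SD pi ST SA)) (map fst w) < k <= size w)%N ->
  succ ST SA (take k w).
Proof.
set D := find _ _ => w0 w_succ /andP[lt_k le_k].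
have /succP[M [lt_M M_ST M_SA]] := w_succ.
have le_D : (D <= M)%N.
  rewrite leqNgt; apply/negP => /(before_find (sI G)).
  by rewrite /= M_ST.
have lt_D : (D < size w)%N := leq_ltn_trans le_D lt_M.
have := nth_find (sI G) (_ : has (fun s => (s \in ST) || (s \in SD pi ST SA)) (map fst w)).
rewrite has_find size_map => /(_ lt_D) /orP[D_ST|].
  apply/succP; exists D; rewrite size_takel // map_take !nth_take //; split=> // t lt_t.
  by rewrite nth_take ?(ltn_trans lt_t) // M_SA // (leq_trans lt_t).
rewrite -/D inE => /eqP v0.
have z0 : Z by case: (w) lt_D => [|z].
have := pfull_drop z0 w0 lt_D; rewrite -(nth_map _ (sI G)) // => drop0.
have := succ_full_T_le (nth (sI G) (map fst w) D) (size (drop D w)).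
rewrite v0 leNgt => /negP[].
rewrite /succ_full_T (bigD1 (in_tuple (drop D w))) //=.
rewrite ltr_pwDl ?sumr_ge0 // => [|u _]; last by rewrite mulr_ge0 ?pfull_ge0.
have -> : succ ST SA (drop D w).
  apply/succP; exists (M - D)%N; rewrite size_drop ltn_sub2r // map_drop.
  rewrite nth_drop subnKC //; split=> // t lt_t.
  by rewrite nth_drop M_SA // -ltn_subRL.
by rewrite mulr1 lt_def drop0 pfull_ge0.
Qed.

(** The sum is the mean number of [k < n] such that a path succeeds within [n] steps but not within
    [k]. By [succ_take] every such [k] is below the length of the path. *)
Lemma sum_succ_full_T_le_l_full n r : l_full pi ST SA = r%:E ->
  \sum_(k < n) (F n - F k) <= r.
Proof.
move=> l_r; rewrite -lee_fin -l_r; apply: le_ereal_sup_tmp.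
eexists; [by exists n | rewrite lee_fin].
have -> : \sum_(k < n) (F n - F k) = \sum_(w : n.-tuple Z) full w *
    \sum_(k < n) ((succ ST SA w)%:R - (succ ST SA (take k w))%:R).
  under [RHS]eq_bigr => w _ do rewrite mulr_sumr.
  rewrite [RHS]exchange_big; apply: eq_bigr => k _.
  have := succ_full_T_prefix k (n - k); rewrite subnKC 1?ltnW // => ->.
  by rewrite -sumrB; apply: eq_bigr => w _; rewrite mulrBr.
apply: ler_sum => w _; have [->|w0] := eqVneq (full w) 0; first by rewrite !mul0r.
apply: ler_wpM2l; first exact: pfull_ge0.
case: (boolP (succ ST SA w)) => w_succ; last first.
  apply: (@le_trans _ _ 0) => //; apply: sumr_le0 => k _.
  by rewrite sub0r oppr_le0.
set D := find (fun s => (s \in ST) || (s \in SD pi ST SA)) (map fst w).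
(* A prefix contains index [D] only if its length exceeds [D], so the counted [k] are those up to
   [D] included, which matches the [t+1] in the definition of length. *)
apply: (@le_trans _ _ (\sum_(k < n) (k < D.+1)%:R)).
  apply: ler_sum => k _; rewrite ltnS; case: leqP => [_|lt_D].
    by rewrite gerBl.
  by rewrite succ_take ?subrr // lt_D size_tuple ltnW.
rewrite -natr_sum ler_nat /len_trunc size_tuple -/D.
by rewrite sum_ltn.
Qed.

End ReachAvoid.

(** * Averaging over the random loss time *)

Section RandomLoss.
Variables (N : nat) (R : realType) (G : game N R) (pi : JS G -> JA G -> R).
Variables (ST SA : {set JS G}) (p : R).
Hypotheses (hK : is_kernel G) (hpi : is_policy pi).
Local Notation F := (succ_full_T pi ST SA (sI G)).
Local Notation v := (v_full pi ST SA).
Local Notation v_at := (v_img_at pi ST SA).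

(** The terms of the series and the no-loss term are nonnegative, so finite partial sums bound
    [v_img] from below. *)
Lemma v_img_ge c : 0 <= p <= 1 ->
  (forall e, 0 < e -> exists n, c - e <= \sum_(t < n) (1 - p) ^+ t * p * v_at t) ->
  (c%:E <= v_img pi ST SA p)%E.
Proof.
move=> /andP[p0 p1] H; apply/lee_addgt0Pr => e e0; have [n le_n] := H e e0.
have terms_ge0 t : 0 <= (1 - p) ^+ t * p * v_at t.
  by rewrite !mulr_ge0 ?exprn_ge0 ?subr_ge0 ?v_img_at_ge0.
apply: (@le_trans _ _ ((\sum_(t < n) (1 - p) ^+ t * p * v_at t)%:E + e%:E)%E).
  by rewrite -EFinD lee_fin -lerBlDr.
rewrite leeD2r // -[leLHS]addr0; apply: leeD.
  rewrite -sumEFin -(big_mkord predT (fun t => ((1 - p) ^+ t * p * v_at t)%:E)).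
  by apply: nneseries_lim_ge => t _ _; rewrite lee_fin.
rewrite lee_fin mulr_ge0 //.
exact: le_trans (succ_full_T_ge0 ST SA hK hpi _ 0) (succ_full_T_le ST SA hK hpi _ 0).
Qed.

Lemma v_img_ge0 : 0 <= p <= 1 -> (0 <= v_img pi ST SA p)%E.
Proof.
move=> p01; apply: v_img_ge => // e e0; exists 0%N.
by rewrite big_ord0 sub0r oppr_le0 ltW.
Qed.

(** The first [n] loss times have mass [1 - (1 - p) ^+ n]; since [c <= 1], the missing mass costs at
    most [e]. *)
Lemma v_img_const c : 0 < p <= 1 -> c <= 1 -> (forall t, c <= v_at t) ->
  (c%:E <= v_img pi ST SA p)%E.
Proof.
move=> p01 c1 le_c; have /andP[p0 p1] := p01.
apply: v_img_ge => [|e e0]; first by rewrite ltW.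
have [n /(_ n (leqnn n)) le_n] := expr_small p01 e0; exists n.
have geom : \sum_(t < n) (1 - p) ^+ t * p = 1 - (1 - p) ^+ n.
  elim: n {le_n} => [|n IHn]; first by rewrite big_ord0 expr0 subrr.
  by rewrite big_ord_recr /= IHn exprS; ring.
apply: (@le_trans _ _ (\sum_(t < n) (1 - p) ^+ t * p * c)).
  have q0 : 0 <= (1 - p) ^+ n by rewrite exprn_ge0 // subr_ge0.
  by rewrite -mulr_suml geom; nra.
apply: ler_sum => t _; apply: ler_wpM2l => //.
by rewrite mulr_ge0 ?exprn_ge0 ?subr_ge0 // ltW.
Qed.

(* Both sides increase with [F n]; the step is the tangent-line inequality
   [a * (1 + x - m * ln q) <= q ^+ n.+1] for [exp] at [m * ln q], where
   [a = q `^ m] and [x = n.+1 * ln q]. *)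
Lemma tangent_sum m n : 0 < p < 1 ->
  powR (1 - p) m * (F n + ln (1 - p) * (\sum_(k < n) (F n - F k) - m * F n)) <=
  \sum_(t < n) (1 - p) ^+ t * p * F t + (1 - p) ^+ n * F n.
Proof.
move=> /andP[p0 p1]; have q0 : 0 < 1 - p by rewrite subr_gt0.
elim: n => [|n IHn]; first by rewrite !big_ord0 succ_full_T0 !(mulr0, subrr, addr0).
set a := powR _ _ in IHn *; set l := ln _ in IHn *.
have tangent : a * (1 + l * (n.+1%:R - m)) <= (1 - p) ^+ n.+1.
  have -> : (1 - p) ^+ n.+1 = a * expR (l * (n.+1%:R - m)).
    rewrite /a /powR gt_eqF // -expRD -[X in X ^+ _]lnK ?posrE // -expRM_natl.
    by congr expR; rewrite -/l; ring.
  by apply: ler_wpM2l; [apply: powR_ge0 | apply: expR_ge1Dx].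
have dF : 0 <= F n.+1 - F n by rewrite subr_ge0 succ_full_T_mono.
have sumE : \sum_(k < n.+1) (F n.+1 - F k) =
    \sum_(k < n) (F n - F k) + n.+1%:R * (F n.+1 - F n).
  rewrite big_ord_recr /=.
  rewrite (eq_bigr (fun k : 'I_n => (F n - F k) + (F n.+1 - F n))) => [|k _]; last ring.
  by rewrite big_split /= sumr_const card_ord -[_ *+ n]mulr_natl -natr1; ring.
rewrite sumE big_ord_recr /=.
have := lerD IHn (ler_wpM2r dF tangent).
rewrite exprS; move: (_ ^+ n) (\sum_(k < n) _) (\sum_(t < n) _) (n.+1%:R) => x A B c.
by nra.
Qed.

(** With [m = r / v] in [tangent_sum], the term in [ln (1 - p)] is at least
    [m * ln (1 - p) * (v - F n)], which vanishes in the limit and leaves [a * v]. *)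
Lemma v_img_len r : 0 < p < 1 -> 0 < v -> l_full pi ST SA = r%:E ->
  ((v * powR (1 - p) (r / v))%:E <= v_img pi ST SA p)%E.
Proof.
move=> p01 v0 l_r; have /andP[p0 p1] := p01; set m := r / v.
have q0 : 0 < 1 - p by rewrite subr_gt0.
have l0 : ln (1 - p) <= 0 by rewrite ln_le0 // gerBl ltW.
have m0 : 0 <= m.
  rewrite divr_ge0 ?(ltW v0) //.
  by have := sum_succ_full_T_le_l_full hK hpi 0 l_r; rewrite big_ord0.
set a := powR (1 - p) m; set K := a * (1 - m * ln (1 - p)).
have a0 : 0 <= a by apply: powR_ge0.
have K0 : 0 <= K by rewrite mulr_ge0 // subr_ge0 (le_trans _ ler01) // mulr_ge0_le0.
apply: v_img_ge => [|e e0]; first by rewrite !ltW.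
(* Replacing [v] by [F n] costs [K * (v - F n)] and dropping the tail costs at most [(1 - p) ^+ n];
   with both [v - F n] and the power at most [e / (K + 1)], the total is at most [e]. *)
have d0 : 0 < e / (K + 1) by rewrite divr_gt0 // ltr_wpDl.
have [n1 F_n1] := sup_nat_approx d0 (succ_full_T_le1 ST SA hK hpi (sI G)).
have p01' : 0 < p <= 1 by rewrite p0 ltW.
have [n2 q_n2] := expr_small p01' d0.
set n := maxn n1 n2; exists n.
have q_n := q_n2 n (leq_maxr _ _).
have F_n : v - F n <= e / (K + 1).
  rewrite lerBlDr -lerBlDl; apply: le_trans (ltW F_n1) _.
  exact: succ_full_T_mono (leq_maxl _ _).
have dE : (K + 1) * (e / (K + 1)) = e by rewrite mulrC divfK // gt_eqF // ltr_wpDl.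
have F_le1 : (1 - p) ^+ n * F n <= (1 - p) ^+ n.
  by rewrite ler_piMr ?exprn_ge0 ?succ_full_T_le1 // ltW.
have le_sum : \sum_(t < n) (1 - p) ^+ t * p * F t <=
    \sum_(t < n) (1 - p) ^+ t * p * v_at t.
  apply: ler_sum => t _; apply: ler_wpM2l; last exact: succ_full_T_le_v_img_at.
  by rewrite mulr_ge0 ?exprn_ge0 ?ltW.
apply: le_trans le_sum; have := tangent_sum m n p01; rewrite -/a.
(* The logarithm is nonpositive, so the upper bound [r = m * v] on the sum becomes a lower bound. *)
have : ln (1 - p) * (m * v) <= ln (1 - p) * \sum_(k < n) (F n - F k).
  apply: ler_wnM2l => //; rewrite divfK ?gt_eqF //.
  exact: sum_succ_full_T_le_l_full hK hpi n r l_r.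
move=> /(ler_wpM2l a0); have := ler_wpM2l K0 F_n.
move: dE; rewrite /K; set d := e / _; move: (ln _) (\sum_(k < n) _) => l A.
move: q_n F_le1; rewrite -/d; move: (_ ^+ n) (\sum_(t < n) _) (F n) => x B f.
by move: d => d; nra.
Qed.

End RandomLoss.

(** * Assembling the two bounds, with the degenerate cases *)

Unset Implicit Arguments.
Set Strict Implicit.

Theorem theorem2 (N : nat) (R : realType) (G : game N R)
  (pi : JS G -> JA G -> R) (ST SA : {set JS G}) (p : R) :
  is_kernel G -> is_policy pi ->
  0 < v_full pi ST SA ->
  0 <= p <= 1 ->
  ((Num.max (bound_corr pi ST SA) (bound_len pi ST SA p))%:E
     <= v_img pi ST SA p)%E.
Proof.
move=> hK hpi v0 p01; have := v_img_ge0 ST SA hK hpi p01.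
have v1 := v_full_le1 ST SA hK hpi; have /andP[p_ge0 p_le1] := p01 => img_ge0.
have le0 (c : R) : c <= 0 -> (c%:E <= v_img pi ST SA p)%E.
  by move=> c0; apply: le_trans img_ge0; rewrite lee_fin.
have corr_le_v : bound_corr pi ST SA <= v_full pi ST SA.
  rewrite /bound_corr; case: (C_pi pi) => [r| |]; rewrite gerBl ?sqrtr_ge0 //.
(* For [p = 0] the loss never occurs: the series vanishes, [v_img] is [v_full], and neither bound
   exceeds it. *)
have [p_eq0|p_neq0] := eqVneq p 0.
  have -> : v_img pi ST SA p = (v_full pi ST SA)%:E.
    rewrite /v_img p_eq0 eqxx mul1r eseries0 ?add0e // => t _ _.
    by rewrite mulr0 mul0r.
  rewrite lee_fin ge_max corr_le_v /bound_len p_eq0 subr0 eqxx.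
  by case: (l_full pi ST SA) => [r| |]; rewrite ?powR1 /= mulr1 lexx.
have p_gt0 : 0 < p by rewrite lt_def p_neq0.
rewrite EFin_max ge_max; apply/andP; split.
  (* For non-finite [C_pi] the bound is [v_full - 1], which is nonpositive. *)
  rewrite /bound_corr; case C_r : (C_pi pi) => [r| |]; try by apply: le0; lra.
  apply: v_img_const => //; first by rewrite p_gt0.
    by rewrite (le_trans _ v1) // gerBl sqrtr_ge0.
  by move=> t; apply: v_full_corr.
rewrite /bound_len (negPf p_neq0) mulr0; case l_r : (l_full pi ST SA) => [r| |] //.
have [p_eq1|p_neq1] := eqVneq p 1; last first.
  by apply: v_img_len => //; rewrite p_gt0 lt_def eq_sym p_neq1.
apply: le0; rewrite p_eq1 subrr powR0 ?mulr0 //.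
(* [powR 0 0] is 1, so the case [p = 1] needs a nonzero exponent; horizon 1 already shows that the
   mean length is at least 1. *)
have r_ge1 : 1 <= r.
  rewrite -lee_fin -l_r; apply: le_ereal_sup_tmp.
  eexists; [by exists 1%N | rewrite lee_fin].
  rewrite -[leLHS](sum_pfull hK hpi 1 (sI G)); apply: ler_sum => w _.
  by rewrite /len_trunc size_tuple (minn_idPr _) // mulr1.
by rewrite gt_eqF // divr_gt0 // (lt_le_trans ltr01).
Qed.
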